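(* Let $p\ge1$ and let $\boldsymbol{\beta}=(\beta_n)_{n\in\mathbb N}$ be an alternate base of length $p$. The $\boldsymbol{\beta}$-shift $\Sigma_{\boldsymbol{\beta}}$ is sofic if and only if for all $i\in\{0,\ldots,p-1\}$, the quasi-greedy expansion $d^*_{\boldsymbol{\beta}^{(i)}}(1)$ is ultimately periodic.
   Context: An alternate base of length $p$ is a sequence $\boldsymbol{\beta}=(\beta_n)_{n\in\mathbb N}$ of real numbers greater than $1$ with $\beta_{n+p}=\beta_n$ for all $n$ (it is a Cantor base, i.e. $\prod_n\beta_n=+\infty$). For $n\in\mathbb N$, $\boldsymbol{\beta}^{(n)}=(\beta_n,\beta_{n+1},\ldots)$. Greedy algorithm: for $x\in[0,1]$, $r_{-1}(x)=x$, $\varepsilon_n(x)=\lfloor\beta_n r_{n-1}(x)\rfloor$, $r_n(x)=\beta_nr_{n-1}(x)-\varepsilon_n(x)$; $d_{\boldsymbol{\beta}}(x)=\varepsilon_0(x)\varepsilon_1(x)\cdots$. These words lie over the finite alphabet $A_{\boldsymbol{\beta}}=\{0,\ldots,\max_i\lfloor\beta_i\rfloor\}$. $D_{\boldsymbol{\beta}}=\{d_{\boldsymbol{\beta}}(x)\colon x\in[0,1)\}$, $\Delta_{\boldsymbol{\beta}}=\bigcup_{n\in\mathbb N}D_{\boldsymbol{\beta}^{(n)}}$, and the $\boldsymbol{\beta}$-shift $\Sigma_{\boldsymbol{\beta}}$ is the topological closure of $\Delta_{\boldsymbol{\beta}}$ in $A_{\boldsymbol{\beta}}^{\mathbb N}$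 for the prefix distance. A subshift $S\subseteq A^{\mathbb N}$ is sofic if its set $\mathrm{Fac}(S)$ of finite factors is accepted by a finite automaton. A word is finite if it ends with $0^\omega$, infinite otherwise. Quasi-greedy expansion: $d^*_{\boldsymbol{\beta}}(1)=d_{\boldsymbol{\beta}}(1)$ if $d_{\boldsymbol{\beta}}(1)$ is infinite, and if $d_{\boldsymbol{\beta}}(1)=\varepsilon_0\cdots\varepsilon_{\ell-1}0^\omega$ with $\ell\ge1$, $\varepsilon_{\ell-1}>0$, then $d^*_{\boldsymbol{\beta}}(1)=\varepsilon_0\cdots\varepsilon_{\ell-2}(\varepsilon_{\ell-1}-1)d^*_{\boldsymbol{\beta}^{(\ell)}}(1)$ (recursively, taking the limit if the recursion does not stop). *)

(* Defs.v *)
From HB Require Import structures.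
From mathcomp Require Import all_boot all_order all_algebra.
From mathcomp Require Import all_classical all_reals all_analysis.

Set Implicit Arguments.
Unset Strict Implicit.
Unset Printing Implicit Defensive.

Import Order.TTheory GRing.Theory Num.Theory.

Local Open Scope classical_set_scope.
Local Open Scope ring_scope.

Definition infword (A : Type) : Type := nat -> A.

HB.instance Definition _ (A : Type) := gen_eqMixin (infword A).
HB.instance Definition _ (A : Type) := gen_choiceMixin (infword A).

(* 2 ^ - inf {n | u_n <> v_n}, with the convention 2 ^ - oo = 0. These values
   are rational, so the metric is taken over rat. *)
Definition prefix_dist (A : eqType) (u v : infword A) : rat :=
  if pselect (exists n, u n != v n) is left h then 2 ^- (ex_minn h) else 0.

Lemma prefix_dist_lt (A : eqType) (u v : infword A) (n : nat) :
  prefix_dist u v < 2 ^- n <-> (forall k, (k <= n)%N -> u k = v k).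
Proof.
rewrite /prefix_dist; case: pselect => [h|h].
  case: ex_minnP => m um minm; rewrite ltf_pV2 ?posrE ?exprn_gt0//.
  rewrite ltr_eXn2l// ?ltr1n//; split=> [nm k kn|H].
    apply/eqP/negPn/negP => /minm mk.
    by move: (leq_ltn_trans (leq_trans mk kn) nm); rewrite ltnn.
  by rewrite ltnNge; apply/negP => /H /eqP; apply/negP.
split=> [_ k _|_]; last by rewrite invr_gt0 exprn_gt0.
by apply/eqP/negPn/negP => uv; apply: h; exists k.
Qed.

Section prefix_metric.
Variable A : eqType.
Implicit Types u v w : infword A.

Let distxx u : prefix_dist u u = 0.
Proof.
by rewrite /prefix_dist; case: pselect => // h; have [n] := h; rewrite eqxx.
Qed.

Let dist_ge0 u v : 0 <= prefix_dist u v.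
Proof.
by rewrite /prefix_dist; case: pselect.
Qed.

Let dist_eq0 u v : prefix_dist u v = 0 -> u = v.
Proof.
move=> uv0; apply/funext => n.
by apply: (proj1 (prefix_dist_lt u v n)) => //; rewrite uv0 invr_gt0 exprn_gt0.
Qed.

Let dist_sym u v : prefix_dist u v = prefix_dist v u.
Proof.
have le a b : prefix_dist a b <= prefix_dist b a.
  rewrite [leRHS]/prefix_dist; case: pselect => [h|h].
    case: ex_minnP => m _ minm; rewrite leNgt; apply/negP.
    rewrite {1}/prefix_dist; case: pselect => [h'|h'].
      case: ex_minnP => m' ab _; have := minm m'; rewrite eq_sym => /(_ ab) mm'.
      by rewrite ltf_pV2 ?posrE ?exprn_gt0// ltr_eXn2l ?ltr1n// ltnNge mm'.
    by rewrite ltNge invr_ge0 exprn_ge0.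
  rewrite /prefix_dist; case: pselect => // -[k ab].
  by case: h; exists k; rewrite eq_sym.
by apply/eqP; rewrite eq_le !le.
Qed.

Let dist_triangle v u w :
  prefix_dist u w <= prefix_dist u v + prefix_dist v w.
Proof.
rewrite {1}/prefix_dist; case: pselect => [h|_]; last by rewrite addr_ge0.
case: ex_minnP => m uw _; rewrite leNgt; apply/negP => H.
have uv : prefix_dist u v < 2 ^- m by apply: le_lt_trans H; rewrite lerDl.
have vw : prefix_dist v w < 2 ^- m by apply: le_lt_trans H; rewrite lerDr.
move/negP: uw; apply; apply/eqP; transitivity (v m).
  exact: (proj1 (prefix_dist_lt _ _ _) uv).
exact: (proj1 (prefix_dist_lt _ _ _) vw).
Qed.

HB.instance Definition _ := isMetric.Build rat (infword A)
  distxx dist_eq0 dist_sym dist_triangle.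

End prefix_metric.

Definition shift_word (A : Type) (n : nat) (w : infword A) : infword A :=
  fun k => w (n + k)%N.

Definition ultimately_periodic (A : Type) (w : infword A) : Prop :=
  exists m q : nat, (0 < q)%N /\ forall n, (m <= n)%N -> w (n + q)%N = w n.

Record automaton (A : Type) := Automaton {
  state : finType;
  initial : {set state};
  final : {set state};
  transition : state -> A -> state -> bool }.

Fixpoint run (A : Type) (N : automaton A) (s : state N) (u : seq A)
    (t : state N) : Prop :=
  if u is a :: u' then exists2 r, transition s a r & run r u' t else s = t.

Definition accepted (A : Type) (N : automaton A) : set (seq A) :=
  [set u | exists s t : state N,
     [/\ s \in initial N, t \in final N & run s u t]].

Definition Fac (A : Type) (S : set (infword A)) : set (seq A) :=
  [set u | exists w k n, S w /\ u = mkseq (shift_word k w) n].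

Definition subshift (A : eqType) (S : set (infword A)) : Prop :=
  closed S /\ forall w, S w -> S (shift_word 1 w).

Definition sofic (A : finType) (S : set (infword A)) : Prop :=
  exists N : automaton A, accepted N = Fac S.

Unset Implicit Arguments.

Section expansions.
Context {R : realType}.
Implicit Types (b : infword R) (x : R).

Definition alternate_base (p : nat) b : Prop :=
  (forall n, 1 < b n) /\ (forall n, b (n + p)%N = b n).

(* [remainder b x n] is r_{n-1}(x). On the nonnegative reals that occur here,
   [Num.truncn] is the floor. *)
Fixpoint remainder b x (n : nat) : R :=
  if n is m.+1 then
    b m * remainder b x m - (Num.truncn (b m * remainder b x m))%:R
  else x.

Definition greedy b x : infword nat :=
  fun n => Num.truncn (b n * remainder b x n).

(* Expansions of the points of [0, 1), as words over {0, ..., M}. *)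
Definition expansions (M : nat) b : set (infword 'I_M.+1) :=
  [set w : infword 'I_M.+1 | exists2 x : R, 0 <= x < 1 &
     forall k, w k = greedy b x k :> nat].

(* By periodicity the maximum over one period is the maximum over all i. *)
Definition max_digit (p : nat) b : nat := (\max_(i < p) Num.truncn (b i))%N.

Definition Delta (p : nat) b : set (infword 'I_(max_digit p b).+1) :=
  \bigcup_n expansions (max_digit p b) (shift_word n b).

Definition beta_shift (p : nat) b : set (infword 'I_(max_digit p b).+1) :=
  closure (Delta p b).

Definition finite_word (w : infword nat) : Prop :=
  exists l, `[< forall k, (l <= k)%N -> w k = 0%N >].

(* Least l such that w = w_0 ... w_{l-1} 0^omega. *)
Definition word_length {w : infword nat} (h : finite_word w) : nat := ex_minn h.

(* Quasi-greedy expansion of 1 with the recursion unfolded at most m times. *)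
Fixpoint quasi_greedy_iter (m : nat) b : infword nat :=
  let w := greedy b 1 in
  if m is m'.+1 then
    if pselect (finite_word w) is left h then
      let l := word_length h in
      fun k => if (k.+1 < l)%N then w k
               else if k.+1 == l then (w k).-1
               else quasi_greedy_iter m' (shift_word l b) (k - l)%N
    else w
  else w.

(* Each unfolding produces at least one more digit of the limit, so the digit
   of index k is settled after k.+1 unfoldings; see [quasi_greedy_iter_stable]
   and [quasi_greedy_finite]. *)
Definition quasi_greedy b : infword nat :=
  fun k => quasi_greedy_iter k.+1 b k.

Lemma word_length_gt0 b (h : finite_word (greedy b 1)) :
  1 < b 0%N -> (0 < word_length h)%N.
Proof.
move=> b1; rewrite /word_length; case: ex_minnP => -[|//] /asboolP/(_ 0%N isT).
rewrite /greedy /= mulr1 => b0 _; have := ltW b1.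
by rewrite -(@truncn_ge_nat _ _ 1) ?b0// (le_trans _ (ltW b1)).
Qed.

Lemma quasi_greedy_iter_stable b k m : (forall n, 1 < b n) -> (k < m)%N ->
  quasi_greedy_iter m b k = quasi_greedy b k.
Proof.
move=> b1 km; rewrite /quasi_greedy.
have gen N : forall k m m' b, (k < N)%N -> (k < m)%N -> (k < m')%N ->
    (forall n, 1 < b n) -> quasi_greedy_iter m b k = quasi_greedy_iter m' b k.
  elim: N => // N IH {}k {}m m' {}b kN {}km km' {}b1.
  case: m km => // m km; case: m' km' => // m' km' /=.
  case: pselect => // h; have l0 := word_length_gt0 _ h (b1 0%N).
  case: ltnP => // lk1; case: eqP => // /eqP nl.
  have lk : (word_length h <= k)%N by rewrite -ltnS ltn_neqAle eq_sym nl lk1.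
  have kl : (k - word_length h < k)%N.
    by rewrite ltn_subrL l0 (leq_trans l0 lk).
  by apply: IH => [|||n]; rewrite /shift_word ?(leq_trans kl)// -ltnS.
exact: (gen k.+1).
Qed.

Lemma quasi_greedy_infinite b :
  ~ finite_word (greedy b 1) -> quasi_greedy b = greedy b 1.
Proof.
by move=> h; apply/funext => k; rewrite /quasi_greedy /=; case: pselect.
Qed.

Lemma quasi_greedy_finite b (h : finite_word (greedy b 1)) :
  (forall n, 1 < b n) ->
  let l := word_length h in
  quasi_greedy b = fun k =>
    if (k.+1 < l)%N then greedy b 1 k
    else if k.+1 == l then (greedy b 1 k).-1
    else quasi_greedy (shift_word l b) (k - l)%N.
Proof.
move=> b1 l; apply/funext => k; rewrite {1}/quasi_greedy /=.
case: pselect => // h'; rewrite (Prop_irrelevance h' h) -/l.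
have l0 : (0 < l)%N := word_length_gt0 _ h (b1 0%N).
case: ltnP => // lk1; case: eqP => // /eqP nl.
have lk : (l <= k)%N by rewrite -ltnS ltn_neqAle eq_sym nl lk1.
apply: quasi_greedy_iter_stable => [n|]; first exact: b1.
by rewrite ltn_subrL l0 (leq_trans l0 lk).
Qed.

Lemma remainder_shift b x n :
  remainder (shift_word 1 b) (remainder b x 1) n = remainder b x n.+1.
Proof. by elim: n => // n IH; rewrite [LHS]/= IH. Qed.

Lemma subshift_beta_shift p b :
  (forall n, 1 < b n) -> subshift (beta_shift p b).
Proof.
move=> b1; split; first exact: closed_closure.
have DS w : Delta p b w -> Delta p b (shift_word 1 w).
  move=> [n _ [x /andP[x0 _] wx]]; exists n.+1 => //.
  exists (remainder (shift_word n b) x 1).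
    have : 0 <= shift_word n b 0%N * x.
      by rewrite mulr_ge0// (le_trans _ (ltW (b1 _))).
    by move=> /truncn_itv/= /andP[? ?]; rewrite subr_ge0 ltrBlDl natr1; apply/andP.
  have -> : shift_word n.+1 b = shift_word 1 (shift_word n b).
    by apply/funext => j; rewrite /shift_word addSn -addnS.
  by move=> k; rewrite [LHS]wx /greedy remainder_shift.
have small (e : rat) : 0 < e -> exists n : nat, 2 ^- n < e.
  move=> e0; exists (Num.bound e^-1).
  rewrite invf_plt ?posrE ?exprn_gt0//; apply: lt_trans (archi_boundP _) _.
    by rewrite invr_ge0 ltW.
  by rewrite -natrX ltr_nat ltn_expl.
move=> w wS B /nbhs_ballP[e /= e0 eB].
have [n ne] := small e e0.
have [|v [Dv]] := wS (ball w (2 ^- n.+1)).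
  by apply: nbhsx_ballx; rewrite invr_gt0 exprn_gt0.
rewrite ballEmdist/= => /prefix_dist_lt wv.
exists (shift_word 1 v); split; first exact: DS.
apply: eB; rewrite ballEmdist/=; apply: lt_trans ne.
by apply/prefix_dist_lt => k kn; apply: wv.
Qed.

End expansions.

(* Main.v *)
Require Import Defs.
From mathcomp Require Import all_boot all_order all_algebra.
From mathcomp Require Import all_classical all_reals all_analysis.
From mathcomp Require Import lra.

(* A word u is a factor of the beta-shift iff, for some i, it is a prefix of
   the expansion of a point of [0, 1) in base b^(i). Reading u from [0, 1)
   leaves an interval [0, t) of possible remainders, and t obeys
   t' = min 1 (b t - a), with the digit a allowed iff a < b t. Taking the largest
   allowed digit at each step, starting from t = 1, produces the quasi-greedy
   expansion of 1; any smaller digit resets t to 1. So if the quasi-greedy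
   expansions are ultimately periodic, finitely many pairs (position mod p, t)
   occur, and they are the states of an automaton.

   Conversely, a factor compatible with the least number of alignments i mod p,
   followed by enough zeros, gives for each j a word w such that w v is a factor
   iff v is admissible in base b^(j) from t = 1. By the pigeonhole principle two
   prefixes of the quasi-greedy expansion of 1 in base b^(j), read after w, reach
   the same set of states, hence have the same continuations. The maximal
   continuations are the tails of the expansion, so these two tails agree. *)

Section beta_shifts.
Set Implicit Arguments.
Unset Strict Implicit.
Unset Printing Implicit Defensive.

Import Order.TTheory GRing.Theory Num.Theory.
Local Open Scope classical_set_scope.
Local Open Scope ring_scope.

(** * Shifts of words and geometric growth *)

Lemma shift_wordD (A : Type) (w : infword A) m n :
  shift_word m (shift_word n w) = shift_word (n + m)%N w.
Proof. by apply/funext => k; rewrite /shift_word addnA. Qed.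

(** Bernoulli's inequality [bern]. It serves both the uniqueness of expansions and the choice of the
    length of zero blocks. *)
Lemma exprn_unbounded (R : archiRealFieldType) (c x : R) :
  1 < c -> exists n, x < c ^+ n.
Proof.
move=> c1; have bern n : 1 + (c - 1) *+ n <= c ^+ n.
  elim: n => [|n IH]; first by rewrite mulr0n addr0 expr0.
  rewrite exprS mulrSr addrA.
  have c0 : 0 <= c - 1 by rewrite subr_ge0 ltW.
  have : 0 <= (c - 1) * ((c - 1) *+ n) by rewrite mulr_ge0// mulrn_wge0.
  have : c * (1 + (c - 1) *+ n) <= c * c ^+ n.
    by rewrite ler_pM2l// (lt_trans _ c1).
  move: (_ *+ n) => y; nra.
have : 0 <= `|x| / (c - 1) by rewrite divr_ge0// subr_ge0 ltW.
move=> /archi_boundP; set n := Num.bound _ => h; exists n.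
apply: lt_le_trans (bern n).
move: h; rewrite ltr_pdivrMr ?subr_gt0// mulrC mulr_natr => h.
by have := ler_norm x; lra.
Qed.

(** * The quasi-greedy orbit of 1 and its digits *)

(* The ceiling of y, minus 1: the largest natural number smaller than y > 0. *)
Definition quasi_digit (R : realType) (y : R) : nat :=
  if (Num.truncn y)%:R == y then (Num.truncn y).-1 else Num.truncn y.

Lemma quasi_digitP (R : realType) (y : R) :
  0 < y -> (quasi_digit y)%:R < y <= (quasi_digit y).+1%:R.
Proof.
move=> y0; have /andP[ty yt] := truncn_itv (ltW y0).
rewrite /quasi_digit; case: eqP => [e|/eqP n]; last first.
  by rewrite lt_neqAle n ty ltW.
have t0 : (0 < Num.truncn y)%N by rewrite -(ltr_nat R) e.
by rewrite prednK// e lexx andbT -[ltRHS]e ltr_nat ltn_predL.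
Qed.

Lemma quasi_digit_max (R : realType) (y : R) (a : nat) :
  0 < y -> (a%:R < y) = (a <= quasi_digit y)%N.
Proof.
move=> /quasi_digitP/andP[qy yq]; apply/idP/idP => h.
  by rewrite -ltnS -(ltr_nat R) (lt_le_trans h).
by rewrite (le_lt_trans _ qy)// ler_nat.
Qed.

(* The orbit of 1 under the quasi-greedy map of (0, 1], which picks the largest
   digit that leaves a positive remainder. *)
Fixpoint quasi_rem (R : realType) (b : infword R) (k : nat) : R :=
  if k is m.+1 then
    b m * quasi_rem b m - (quasi_digit (b m * quasi_rem b m))%:R
  else 1.

Lemma quasi_rem_itv (R : realType) (b : infword R) k :
  (forall n, 1 < b n) -> 0 < quasi_rem b k <= 1.
Proof.
move=> b1; elim: k => [|k /andP[IH _]] /=; first by rewrite ltr01 lexx.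
have := quasi_digitP (mulr_gt0 (lt_trans ltr01 (b1 k)) IH).
by rewrite subr_gt0 lerBlDr nat1r.
Qed.

Lemma quasi_rem_restart (R : realType) (b : infword R) l k :
  quasi_rem b l = 1 ->
  quasi_rem b (l + k) = quasi_rem (shift_word l b) k.
Proof. by move=> l1; elim: k => [|k IH]; rewrite ?addn0// addnS /= IH. Qed.

Lemma shift_word_mod (A : Type) p (b : infword A) n :
  (forall k, b (k + p)%N = b k) -> shift_word (n %% p) b = shift_word n b.
Proof.
move=> bp; apply/funext => k; rewrite /shift_word [in RHS](divn_eq n p).
elim: (n %/ p)%N => [|d ->]; first by rewrite mul0n.
by rewrite mulSn -!addnA [in RHS]addnC bp.
Qed.

(** Periodicity leaves only [p] values to bound, hence a uniform rate of expansion. *)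
Lemma base_ge_gt1 (R : realType) p (b : infword R) :
  (0 < p)%N -> alternate_base p b -> exists2 c : R, 1 < c & forall n, c <= b n.
Proof.
move=> p0 [b1 bp].
have per n : b n = b (n %% p)%N.
  by have /(congr1 (@^~ 0%N)) := shift_word_mod n bp; rewrite /shift_word !addn0.
have [c c1 cP] : exists2 c : R, 1 < c & forall n, (n < p)%N -> c <= b n.
  elim: (p) => [|q [c c1 IH]]; first by exists 2 => //; rewrite ltr1n.
  exists (Num.min c (b q)); first by rewrite lt_min c1 b1.
  move=> n; rewrite ltnS leq_eqVlt => /predU1P[->|/IH h].
    by rewrite ge_min lexx orbT.
  by rewrite ge_min h.
by exists c => // n; rewrite per cP// ltn_mod.
Qed.

Lemma alternate_base_shift (R : realType) p (b : infword R) n :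
  alternate_base p b -> alternate_base p (shift_word n b).
Proof. by move=> [b1 bp]; split=> k; rewrite /shift_word ?addnA. Qed.

Lemma remainder_itv (R : realType) (b : infword R) x k :
  (forall n, 0 <= b n) -> 0 <= x < 1 -> 0 <= remainder b x k < 1.
Proof.
move=> b0 x01; elim: k => //= k /andP[IH _].
by have := truncn_itv (mulr_ge0 (b0 k) IH); rewrite subr_ge0 ltrBlDl natr1.
Qed.

Lemma remainder_ge0 (R : realType) (b : infword R) x k :
  (forall n, 0 <= b n) -> 0 <= x -> 0 <= remainder b x k.
Proof.
move=> b0 x0; elim: k => //= k IH.
by have := truncn_itv (mulr_ge0 (b0 k) IH); rewrite subr_ge0 => /andP[].
Qed.

Lemma remainder_shiftD (R : realType) (b : infword R) x m n :
  remainder (shift_word m b) (remainder b x m) n = remainder b x (m + n).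
Proof. by elim: n => [|n IH]; rewrite ?addn0// addnS /= IH. Qed.

(* Two orbits with the same digits drift apart by the factor b n >= c at each
   step, and must stay in a bounded set. *)
Lemma expansion_uniq (R : realType) (c : R) (b : infword R) (d : infword nat)
    (x y : nat -> R) :
  1 < c -> (forall n, c <= b n) ->
  (forall n, 0 <= x n <= 1) -> (forall n, 0 <= y n <= 1) ->
  (forall n, x n.+1 = b n * x n - (d n)%:R) ->
  (forall n, y n.+1 = b n * y n - (d n)%:R) ->
  x 0%N = y 0%N.
Proof.
move=> c1 cb x01 y01 xd yd; apply/eqP; rewrite -subr_eq0 -normr_le0 leNgt.
apply/negP => n0; have [n] := exprn_unbounded (`|x 0%N - y 0%N|^-1) c1.
have : c ^+ n * `|x 0%N - y 0%N| <= `|x n - y n|.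
  elim: n => [|n IH]; first by rewrite expr0 mul1r.
  have -> : x n.+1 - y n.+1 = b n * (x n - y n) by rewrite xd yd; lra.
  have c0 : 0 <= c by rewrite (le_trans ler01)// ltW.
  rewrite normrM exprS -mulrA (le_trans (ler_wpM2l c0 IH))//.
  by rewrite ler_wpM2r// (le_trans (cb n))// ler_norm.
move=> h1; rewrite -div1r ltr_pdivrMr// => h2.
have := lt_le_trans h2 h1; rewrite ltNge => /negP; apply.
by rewrite ler_norml; have := x01 n; have := y01 n; lra.
Qed.

(** The tails of the orbit at [k] and [r + k] have the same base and the same digits, so
    [expansion_uniq] identifies their starting points. This turns periodic digits into periodic
    remainders. *)
Lemma quasi_rem_eq (R : realType) (c : R) (b : infword R) m r :
  1 < c -> (forall n, c <= b n) -> (forall n, b (r + n)%N = b n) ->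
  (forall k, (m <= k)%N -> quasi_digit (b (r + k)%N * quasi_rem b (r + k))
                 = quasi_digit (b k * quasi_rem b k)) ->
  forall k, (m <= k)%N -> quasi_rem b (r + k) = quasi_rem b k.
Proof.
move=> c1 cb br dd k mk.
have itv n : 0 <= quasi_rem b n <= 1.
  have b1 j : 1 < b j by apply: lt_le_trans (cb j).
  by have /andP[/ltW -> ->] := quasi_rem_itv n b1.
have := @expansion_uniq _ c (shift_word k b)
  (fun n => quasi_digit (b (k + n)%N * quasi_rem b (k + n)))
  (fun n => quasi_rem b (r + (k + n))) (fun n => quasi_rem b (k + n)).
rewrite addn0; apply => // n.
- exact: cb.
- by rewrite !addnS /= dd ?br// (leq_trans mk)// leq_addr.
- by rewrite addnS.
Qed.

(** While the greedy remainder is nonzero, both algorithms choose the same digit. When it first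
    vanishes, the last product is an integer: the quasi-greedy digit is one less, its remainder is 1
    instead of 0, and both sides restart in the shifted base. Hence the strong induction on [k]. *)
Lemma quasi_greedyE (R : realType) p (b : infword R) k :
  (0 < p)%N -> alternate_base p b ->
  quasi_greedy b k = quasi_digit (b k * quasi_rem b k).
Proof.
move=> p0; elim/ltn_ind: k b => k IH b bb; have [b1 _] := bb.
have b0 n : 0 <= b n by rewrite (le_trans ler01)// ltW.
have rem0 m n : remainder b 1 m = 0 -> remainder b 1 (m + n) = 0.
  move=> m0; elim: n => [|n e]; first by rewrite addn0.
  by rewrite addnS /= e mulr0 truncn0 subrr.
have follow l : (forall j, (j <= l)%N -> remainder b 1 j != 0) ->
    quasi_rem b l = remainder b 1 l /\ (forall j, (j < l)%N ->
    greedy b 1 j = quasi_digit (b j * quasi_rem b j)).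
  elim: l => // l IHl nz; have [|e h] := IHl.
    by move=> j jl; apply: nz; rewrite (leq_trans jl).
  have q : greedy b 1 l = quasi_digit (b l * quasi_rem b l).
    rewrite e /greedy /quasi_digit; case: eqP => // t.
    by have := nz _ (leqnn _); rewrite /= t subrr eqxx.
  split; first by rewrite [LHS]/= -q e.
  by move=> j; rewrite ltnS leq_eqVlt => /predU1P[->|/h].
have [h|h] := pselect (finite_word (greedy b 1)); last first.
  rewrite quasi_greedy_infinite//; apply: (proj2 (follow k.+1 _)) => // j _.
  apply/eqP => j0; apply: h; exists j; apply/asboolP => i /subnKC <-.
  by rewrite /greedy rem0// mulr0 truncn0.
rewrite quasi_greedy_finite//; have l0 := word_length_gt0 _ h (b1 0%N).
have [nz lz lw] : [/\ forall j, (j < word_length h)%N ->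
      remainder b 1 j != 0, remainder b 1 (word_length h) = 0 &
      (0 < greedy b 1 (word_length h).-1)%N].
  move: l0; rewrite /word_length; case: ex_minnP => l /asboolP z minl l0.
  have lw : (0 < greedy b 1 l.-1)%N.
    rewrite lt0n; apply/negP => /eqP w0.
    suff /minl : `[< forall j, (l.-1 <= j)%N -> greedy b 1 j = 0%N >].
      by rewrite leqNgt ltn_predL l0.
    apply/asboolP => j; rewrite leq_eqVlt => /predU1P[<-//|].
    by rewrite prednK//; apply: z.
  split=> // [j jl|].
    apply/eqP => j0; move: lw; rewrite -(@subnKC j l.-1) ?rem0//; last first.
      by rewrite -ltnS prednK.
    by rewrite /greedy rem0// mulr0 truncn0.
  (* From [l] on all greedy digits are 0, as for the zero orbit, so uniqueness forces the remainder
     at [l] to vanish. *)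
  have [c c1 cb] := base_ge_gt1 p0 bb.
  rewrite -[l]addn0.
  apply: (@expansion_uniq _ c (shift_word l b) (fun=> 0%N)
    (fun n => remainder b 1 (l + n)) (fun=> 0)) => // n; rewrite ?lexx ?ler01//.
  - exact: cb.
  - case: l l0 {z minl lw} => // l _; rewrite addSn /=.
    have := truncn_itv (mulr_ge0 (b0 (l + n)%N) (remainder_ge0 (l + n) b0 ler01)).
    by rewrite subr_ge0 lerBlDl natr1 => /andP[-> /ltW].
  - by rewrite addnS /= -/(greedy b 1 (l + n)%N) z// leq_addr.
  - by rewrite mulr0 subrr.
move: (word_length h) l0 nz lz lw => [//|l] _ nz lz lw.
have [rl gl] := follow l nz.
have /eqP int : (greedy b 1 l)%:R == b l * quasi_rem b l.
  by move: lz; rewrite rl /= => /eqP; rewrite subr_eq0 eq_sym.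
have dl : quasi_digit (b l * quasi_rem b l) = (greedy b 1 l).-1.
  by rewrite -int /quasi_digit natrK eqxx.
case: ltnP => [|lk]; first exact: gl.
case: eqP => [[->]|/eqP kl]; first by rewrite dl.
have {}lk : (l < k)%N by rewrite ltn_neqAle eq_sym -eqSS kl.
have q1 : quasi_rem b l.+1 = 1.
  by rewrite /= dl -int -[in X in X - _](prednK lw) -natr1 addrAC subrr add0r.
rewrite IH ?ltn_subrL ?(leq_trans _ lk)//; last exact: alternate_base_shift.
by rewrite -quasi_rem_restart// /shift_word subnKC.
Qed.

(** * Admissible words and greedy expansions *)

(* Reading the digit a turns the set [0, t) of possible greedy remainders into
   [0, min 1 (b 0 * t - a)), which must be nonempty: u is admissible from t iff
   it is a prefix of the greedy expansion of some x in [0, t). *)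
Fixpoint residue (R : realType) (b : infword R) (t : R) (u : seq nat) : R :=
  if u is a :: u' then
    residue (shift_word 1 b) (Num.min 1 (b 0%N * t - a%:R)) u'
  else t.

Fixpoint admissible (R : realType) (b : infword R) (t : R) (u : seq nat) :
    bool :=
  if u is a :: u' then (a%:R < b 0%N * t) &&
    admissible (shift_word 1 b) (Num.min 1 (b 0%N * t - a%:R)) u'
  else true.

Lemma admissible_cat (R : realType) (b : infword R) t u v :
  admissible b t (u ++ v) = admissible b t u &&
    admissible (shift_word (size u) b) (residue b t u) v.
Proof.
by elim: u b t => //= a u IH b t; rewrite IH andbA shift_wordD add1n.
Qed.

Lemma residue_cat (R : realType) (b : infword R) t u v :
  residue b t (u ++ v) = residue (shift_word (size u) b) (residue b t u) v.
Proof. by elim: u b t => //= a u IH b t; rewrite IH shift_wordD add1n. Qed.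

Lemma residue_itv (R : realType) (b : infword R) t u :
  0 < t <= 1 -> admissible b t u -> 0 < residue b t u <= 1.
Proof.
elim: u b t => //= a u IH b t t01 /andP[abt]; apply: IH.
by rewrite lt_min ltr01 subr_gt0 abt ge_min lexx.
Qed.

Lemma mkseq_head (A : Type) (f : nat -> A) n :
  mkseq f n.+1 = f 0%N :: mkseq (fun k => f k.+1) n.
Proof. by rewrite /mkseq /= (iotaDl 1 0) -map_comp. Qed.

Lemma admissible_greedy (R : realType) (b : infword R) t x n :
  (forall k, 0 < b k) -> 0 <= x < t -> admissible b t (mkseq (greedy b x) n).
Proof.
elim: n b t x => // n IH b t x b0 /andP[x0 xt].
have bx : b 0%N * x < b 0%N * t by rewrite ltr_pM2l.
have := truncn_itv (mulr_ge0 (ltW (b0 0%N)) x0).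
rewrite mkseq_head /= {1 3}/greedy /= => /andP[rx xr].
rewrite (le_lt_trans rx bx) /=.
have -> : mkseq (fun k => greedy b x k.+1) n =
    mkseq (greedy (shift_word 1 b) (remainder b x 1)) n.
  by apply: eq_mkseq => k; rewrite /greedy remainder_shift.
apply: IH => [k|]; first exact: b0.
by rewrite /= subr_ge0 rx lt_min ltrBlDl natr1 xr ltrD2r.
Qed.

Lemma greedy_admissible (R : realType) (b : infword R) t u :
  (forall k, 0 < b k) -> 0 < t -> admissible b t u ->
  exists2 x, 0 <= x < t & u = mkseq (greedy b x) (size u).
Proof.
elim: u b t => [|a u IH] b t b0 t0 /=; first by exists 0; rewrite // lexx.
move=> /andP[abt]; set t' := Num.min _ _ => /IH[|| x /andP[x0]].
- by move=> k; apply: b0.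
- by rewrite lt_min ltr01 subr_gt0.
(* The preimage of [x] under the branch of digit [a]; [x < 1] makes [a] its first greedy digit. *)
rewrite lt_min => /andP[x1 xt] ux; exists ((x + a%:R) / b 0%N).
  rewrite ltr_pdivrMr// (mulrC t) -ltrBrDr xt andbT.
  by rewrite divr_ge0 ?addr_ge0// ltW.
have bx : b 0%N * ((x + a%:R) / b 0%N) = x + a%:R.
  by rewrite mulrC divfK// gt_eqF.
have ax : Num.truncn (x + a%:R) = a.
  by apply: truncn_def; rewrite lerDr x0 -nat1r ltrD2r.
rewrite mkseq_head {1}/greedy /= bx ax; congr cons; rewrite [LHS]ux.
apply: eq_mkseq => k; rewrite {1}/greedy; congr Num.truncn.
by rewrite /greedy -remainder_shift /= bx ax addrK.
Qed.

Lemma admissible_zeros (R : realType) (b : infword R) t k :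
  (forall n, 0 < b n) -> 0 < t -> admissible b t (nseq k 0%N).
Proof.
elim: k b t => //= k IH b t b0 t0; rewrite mulr_gt0//= IH//.
  by move=> n; apply: b0.
by rewrite subr0 lt_min ltr01 mulr_gt0.
Qed.

(** Each zero multiplies the residue by at least [c] until the cap 1 is reached, where it stays. *)
Lemma residue_zeros (R : realType) (c : R) (b : infword R) t k :
  1 < c -> (forall n, c <= b n) -> 0 < t <= 1 -> 1 <= t * c ^+ k ->
  residue b t (nseq k 0%N) = 1.
Proof.
move=> c1; elim: k b t => [|k IH] b t cb /andP[t0 t1] /=.
  by rewrite expr0 mulr1 => h; apply/eqP; rewrite eq_le t1.
move=> h; have c0 : 0 < c by rewrite (lt_trans ltr01).
have bt0 : 0 < b 0%N * t by rewrite mulr_gt0// (lt_le_trans c0).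
rewrite subr0; apply: IH; first by move=> n; apply: cb.
  by rewrite lt_min ltr01 bt0 ge_min lexx.
rewrite minEle; case: ifP => _.
  by rewrite mul1r exprn_ege1// ltW.
apply: le_trans h _; rewrite exprS mulrA ler_pM2r ?exprn_gt0// mulrC.
by rewrite ler_pM2r.
Qed.

(** The quasi-greedy expansion freed from its recursion on restarts, by [quasi_greedyE]. *)
Definition quasi_word (R : realType) (b : infword R) : infword nat :=
  fun k => quasi_digit (b k * quasi_rem b k).

(** The quasi-greedy digit leaves at most 1, so the cap in [residue] never acts. *)
Lemma admissible_quasi (R : realType) (b : infword R) n :
  (forall k, 1 < b k) -> admissible b 1 (mkseq (quasi_word b) n) /\
    residue b 1 (mkseq (quasi_word b) n) = quasi_rem b n.
Proof.
move=> b1; elim: n => [//|n [IH IHr]].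
rewrite mkseqS -cats1 admissible_cat residue_cat IH IHr size_mkseq /=.
rewrite /shift_word addn0 -/(quasi_word b n).
have /andP[q0 _] := quasi_rem_itv n b1.
have := quasi_digitP (mulr_gt0 (lt_trans ltr01 (b1 n)) q0).
rewrite -/(quasi_word b n) => /andP[-> h]; split=> //.
by apply: min_r; rewrite lerBlDr nat1r.
Qed.

(** * Digit bounds and factors of the beta-shift *)

Lemma truncn_le_max_digit (R : realType) p (b : infword R) n :
  (0 < p)%N -> alternate_base p b -> (Num.truncn (b n) <= max_digit p b)%N.
Proof.
move=> p0 [_ bp]; have := shift_word_mod n bp.
move=> /(congr1 (@^~ 0%N)); rewrite /shift_word !addn0 => <-.
exact: (leq_bigmax (F := fun i : 'I_p => Num.truncn (b i))
  (Ordinal (ltn_pmod n p0))).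
Qed.

Lemma greedy_le_max_digit (R : realType) p (b : infword R) i x k :
  (0 < p)%N -> alternate_base p b -> 0 <= x < 1 ->
  (greedy (shift_word i b) x k <= max_digit p b)%N.
Proof.
move=> p0 bb x01; apply: leq_trans (truncn_le_max_digit (i + k) p0 bb).
have b0 n : 0 <= b n by rewrite (le_trans ler01)// ltW// (proj1 bb).
apply: le_truncn; rewrite ler_piMr//; first exact: b0.
by have /andP[_ /ltW] := @remainder_itv _ (shift_word i b) x k (fun=> b0 _) x01.
Qed.

Lemma quasi_word_le_max_digit (R : realType) p (b : infword R) i k :
  (0 < p)%N -> alternate_base p b ->
  (quasi_word (shift_word i b) k <= max_digit p b)%N.
Proof.
move=> p0 bb; apply: leq_trans (truncn_le_max_digit (i + k) p0 bb).
have b0 n : 0 <= b n by rewrite (le_trans ler01)// ltW// (proj1 bb).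
have /andP[_ q1] := @quasi_rem_itv _ (shift_word i b) k (fun=> proj1 bb _).
apply: (@leq_trans (Num.truncn (b (i + k)%N * quasi_rem (shift_word i b) k))).
  by rewrite /quasi_word /quasi_digit; case: ifP => // _; apply: leq_pred.
by apply: le_truncn; rewrite ler_piMr//; apply: b0.
Qed.

(** A word of the closure agrees with some expansion up to any given index, and a tail of a greedy
    expansion is the greedy expansion of a remainder. Conversely, an admissible word is a prefix of
    an element of [Delta]. *)
Lemma Fac_beta_shift (R : realType) p (b : infword R) :
  (0 < p)%N -> alternate_base p b ->
  Fac (beta_shift p b) = [set u | exists2 i, (i < p)%N &
    admissible (shift_word i b) 1 (map val u)].
Proof.
move=> p0 bb; have [b1 bp] := bb.
have b0 n : 0 < b n by rewrite (lt_trans ltr01).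
apply/seteqP; split=> u /=.
  move=> [w [k [n [wS ->]]]].
  have [|v [[m _ [x x01 vx]]]] := wS (ball w (2 ^- (k + n)%N)).
    by apply: nbhsx_ballx; rewrite invr_gt0 exprn_gt0.
  rewrite ballEmdist/= => /prefix_dist_lt wv.
  exists ((m + k) %% p)%N; first exact: ltn_pmod.
  rewrite shift_word_mod// -shift_wordD.
  have -> : map val (mkseq (shift_word k w) n) =
      mkseq (greedy (shift_word k (shift_word m b))
        (remainder (shift_word m b) x k)) n.
    rewrite /mkseq -map_comp; apply/eq_in_map => j; rewrite mem_iota /= => jn.
    rewrite /shift_word wv ?leq_add2l ?(ltnW jn)// vx /greedy.
    by rewrite -remainder_shiftD.
  apply: admissible_greedy => [j|]; first exact: b0.
  by apply: remainder_itv => // j; rewrite ltW// b0.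
move=> [i ip /greedy_admissible[j|//|x x01 ux]]; first exact: b0.
(* Greedy digits are at most [max_digit p b], so [inord] never takes its default value. *)
exists (fun k => inord (greedy (shift_word i b) x k)), 0%N, (size u).
have gd k := greedy_le_max_digit i k p0 bb x01.
split.
  apply: subset_closure; exists i => //; exists x => // k.
  by rewrite inordK// ltnS gd.
apply: (inj_map val_inj); rewrite ux size_map /mkseq -map_comp.
by apply: eq_map => k; rewrite /= inordK// ltnS gd.
Qed.


(** * Ultimately periodic expansions give a sofic shift *)

Lemma shift_word_eqmod (A : Type) p (b : infword A) m n :
  (forall k, b (k + p)%N = b k) -> m = n %[mod p] ->
  shift_word m b = shift_word n b.
Proof.
by move=> bp mn; rewrite -(shift_word_mod m bp) mn shift_word_mod.
Qed.

(** If the digits have period [q] from [m] on, then [q * p] is also a period of the base, hence of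
    the remainders by [quasi_rem_eq]. Subtracting it keeps the class mod [p] and ends below
    [m + q * p]. *)
Lemma finite_quasi_rem (R : realType) p (b : infword R) :
  (0 < p)%N -> alternate_base p b -> ultimately_periodic (quasi_word b) ->
  exists M, forall k, exists k',
    [/\ (k' < M)%N, quasi_rem b k' = quasi_rem b k & k' = k %[mod p]].
Proof.
move=> p0 bb [m [q [q0 qP]]]; have [c c1 cb] := base_ge_gt1 p0 bb.
have rP k : (m <= k)%N -> quasi_rem b (q * p + k) = quasi_rem b k.
  apply: (quasi_rem_eq c1 cb) => {k} [n|k mk].
    have e : shift_word (q * p) b = shift_word 0 b.
      by apply: shift_word_eqmod (proj2 bb) _; rewrite modnMl mod0n.
    by have := congr1 (@^~ n) e.
  rewrite -!/(quasi_word _ _) mulnC addnC.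
  elim: p {p0 bb} => [|p IH]; first by rewrite addn0.
  by rewrite mulSn (addnC q) addnA qP ?IH// (leq_trans mk)// leq_addr.
exists (m + q * p)%N; elim/ltn_ind => k IH.
have [km|mk] := ltnP k (m + q * p); first by exists k.
have qk : (q * p <= k)%N by rewrite (leq_trans _ mk)// leq_addl.
have [|k' [k'M rk' k'k]] := IH (k - q * p)%N.
  by rewrite ltn_subrL muln_gt0 q0 p0 (leq_trans _ qk)// muln_gt0 q0.
exists k'; split=> //.
  by rewrite rk' -rP ?subnKC// leq_subRL// addnC.
by rewrite k'k -[in RHS](subnKC qk) modnMDl.
Qed.

Lemma sofic_beta_shift (R : realType) p (b : infword R) :
  (0 < p)%N -> alternate_base p b ->
  (forall i, (i < p)%N -> ultimately_periodic (quasi_word (shift_word i b))) ->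
  sofic (beta_shift p b).
Proof.
move=> p0 bb per; pose T i k := quasi_rem (shift_word i b) k.
have [b1 bp] := bb.
have [M MP] : exists M, forall i, (i < p)%N -> forall k, exists k',
    [/\ (k' < M)%N, T i k' = T i k & k' = k %[mod p]].
  suff H q : (q <= p)%N -> exists M, forall i, (i < q)%N -> forall k,
      exists k', [/\ (k' < M)%N, T i k' = T i k & k' = k %[mod p]] by exact: H.
  elim: q => [|q IH] qp; first by exists 0%N.
  have [M MP] := IH (ltnW qp).
  have [M' M'P] :=
    finite_quasi_rem p0 (alternate_base_shift q bb) (per _ qp).
  exists (maxn M M') => i; rewrite ltnS leq_eqVlt => /predU1P[->|iq] k.
    by have [k' [kM ? ?]] := M'P k; exists k'; rewrite leq_max kM orbT.
  by have [k' [kM ? ?]] := MP i iq k; exists k'; rewrite leq_max kM.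
pose S : finType := ('I_p * 'I_M)%type.
pose pos (s : S) := (s.1 + s.2)%N.
pose Ts (s : S) := T s.1 s.2.
(* The states stand for the points (pos mod p, Ts), the residues reachable from
   (i, 1): a digit below the quasi-greedy one resets the residue to 1. *)
pose N := @Automaton 'I_(max_digit p b).+1 S [set s : S | s.2 == 0%N :> nat]%SET
  [set: S]%SET (fun s a s' => [&& a%:R < b (pos s) * Ts s,
    Ts s' == Num.min 1 (b (pos s) * Ts s - a%:R) &
    pos s' == (pos s).+1 %[mod p]]).
have runP u (s : state N) : (exists t : state N, run s u t) <->
    admissible (shift_word (pos s) b) (Ts s) (map val u).
  elim: u s => [|a u IH] s; first by split=> // _; exists s.
  have e0 : shift_word (pos s) b 0%N = b (pos s) by rewrite /shift_word addn0.
  rewrite /= e0; have step s' : pos s' = (pos s).+1 %[mod p] ->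
      shift_word 1 (shift_word (pos s) b) = shift_word (pos s') b.
    by move=> e; rewrite shift_wordD addn1; apply: shift_word_eqmod.
  split=> [[t [s' /and3P[-> /eqP <- /eqP e]] st]|/andP[abt]].
    by rewrite (step s' e); apply/IH; exists t.
  suff [s' e1 e2] : exists2 s', Ts s' = Num.min 1 (b (pos s) * Ts s - a%:R) &
      pos s' = (pos s).+1 %[mod p].
    rewrite -e1 (step s' e2) => /IH[t st]; exists t; exists s' => //.
    by rewrite /= abt e1 e2 !eqxx.
  have /andP[T0 T1] := @quasi_rem_itv _ (shift_word s.1 b) s.2 (fun=> b1 _).
  have y0 : 0 < b (pos s) * Ts s by rewrite mulr_gt0// (lt_trans ltr01).
  move: (abt); rewrite quasi_digit_max// leq_eqVlt => /predU1P[ea|la].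
    have [k' [k'M Tk' k'k]] := MP s.1 (ltn_ord _) s.2.+1.
    exists (s.1, Ordinal k'M); last first.
      by rewrite /pos /= -addnS -modnDmr k'k modnDmr.
    rewrite /Ts /= Tk' ea min_r//.
    have := quasi_digitP y0 => /andP[_]; rewrite lerBlDr nat1r; exact.
  (* The orbit has value 1 at index 0; its representative [k'] is 0 mod [p], so the position is not
     disturbed. *)
  have [k' [k'M Tk' k'k]] := MP ((pos s).+1 %% p)%N (ltn_pmod _ p0) 0%N.
  exists (Ordinal (ltn_pmod (pos s).+1 p0), Ordinal k'M).
    rewrite /Ts /= Tk' min_l// lerBrDr nat1r.
    have /andP[+ _] := quasi_digitP y0; move/ltW; apply: le_trans.
    by rewrite ler_nat.
  by rewrite /pos /= -modnDmr k'k mod0n addn0 modn_mod.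
exists N; rewrite Fac_beta_shift//; apply/seteqP; split=> u /=.
  move=> [s [t [s0 _ st]]]; exists s.1 => //.
  have := (runP u s).1 (ex_intro _ t st).
  move: s0; rewrite inE /pos /Ts => /eqP ->; by rewrite addn0.
move=> [i ip adm]; have [k' [k'M _ _]] := MP i ip 0%N.
have M0 : (0 < M)%N by apply: leq_ltn_trans k'M.
have [|t st] := (runP u (Ordinal ip, Ordinal M0)).2.
  by rewrite /pos /Ts /= addn0.
by exists (Ordinal ip, Ordinal M0), t; split; rewrite ?inE.
Qed.

(** * A sofic shift has ultimately periodic expansions *)

Definition reach (A : Type) (N : automaton A) (u : seq A) : {set state N} :=
  [set t : state N | `[< exists2 s, s \in initial N & run s u t >]]%SET.

Lemma run_cat (A : Type) (N : automaton A) (s t : state N) u v :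
  run s (u ++ v) t <-> exists2 r, run s u r & run r v t.
Proof.
elim: u s => [|a u IH] s /=.
  by split=> [|[r ->]//]; exists s.
split=> [[r sr /IH[r' ? ?]]|[r' [r sr ?] ?]]; first by exists r' => //; exists r.
by exists r => //; apply/IH; exists r'.
Qed.

(** As in the subset construction, the set of reached states alone decides the accepted
    continuations. *)
Lemma reach_residual (A : Type) (N : automaton A) (u u' v : seq A) :
  reach N u = reach N u' -> accepted N (u ++ v) -> accepted N (u' ++ v).
Proof.
move=> uu' [s [t [sI tF /run_cat[r sr rt]]]].
have : r \in reach N u by rewrite inE; apply/asboolP; exists s.
rewrite uu' inE => /asboolP[s' s'I s'r].
by exists s', t; split=> //; apply/run_cat; exists r.
Qed.

Lemma pigeonhole_nat (T : finType) (f : nat -> T) :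
  exists m n, (m < n)%N /\ f m = f n.
Proof.
apply: contrapT => H.
have inj : injective (fun i : 'I_#|T|.+1 => f i).
  move=> i j fij; apply: val_inj; have [ij|ij|//] := ltngtP i j.
    by case: H; exists i, j.
  by case: H; exists j, i.
by have := leq_card _ inj; rewrite card_ord ltnn.
Qed.

(* A factor w compatible with as few alignments i < p as possible keeps all of
   them when it is extended, and enough zeros bring its residue back to 1. *)
Lemma synchronizing_word (R : realType) p (b : infword R) j :
  (0 < p)%N -> alternate_base p b ->
  exists w, forall v, Fac (beta_shift p b) (w ++ v) <->
    admissible (shift_word j b) 1 (map val v).
Proof.
move=> p0 bb; have [b1 bp] := bb; have [c c1 cb] := base_ge_gt1 p0 bb.
have b0 n : 0 < b n by rewrite (lt_trans ltr01).
rewrite Fac_beta_shift//.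
pose W := seq 'I_(max_digit p b).+1.
pose S (u : W) :=
  [set i : 'I_p | admissible (shift_word i b) 1 (map val u)]%SET.
have SP (u : W) (i : 'I_p) :
    (i \in S u) = admissible (shift_word i b) 1 (map val u) by rewrite inE.
have : exists n, `[< exists2 u : W, #|S u| = n & (0 < #|S u|)%N >].
  exists #|S [::]|; apply/asboolP; exists [::] => //.
  by apply/card_gt0P; exists (Ordinal p0); rewrite SP.
case/ex_minnP => n /asboolP[u un /card_gt0P[i iu]] nmin.
have umin v (i' : 'I_p) : i' \in S (u ++ v) -> i \in S (u ++ v).
  move=> i'v; suff <- : S u = S (u ++ v) by [].
  apply/esym/eqP; rewrite eqEcard; apply/andP; split.
    by apply/fintype.subsetP => k; rewrite !SP map_cat admissible_cat => /andP[].
  rewrite un; apply: nmin; apply/asboolP; exists (u ++ v) => //.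
  by apply/card_gt0P; exists i'.
have {}iu : admissible (shift_word i b) 1 (map val u) by rewrite -SP.
set t := residue (shift_word i b) 1 (map val u).
have t01 : 0 < t <= 1 by apply: residue_itv => //; rewrite ltr01 lexx.
have /andP[t0 t1] := t01.
have [K tK] := exprn_unbounded t^-1 c1.
(* [K * p] gives enough zeros to bring [t] up to 1, and [m * p.-1] cancels [m] mod [p], so that [v]
   starts at alignment [j]. *)
pose m := (i + size u)%N; pose k := (K * p + (m * p.-1 + j))%N.
have mkj : (m + k)%N = j %[mod p].
  have -> : (m + k = (K + m) * p + j)%N.
    by rewrite /k addnCA (addnA m) -mulnS prednK// addnA -mulnDl.
  by rewrite modnMDl.
exists (u ++ nseq k ord0) => v.
have wz : residue (shift_word m b) t (nseq k 0%N) = 1.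
  apply: (@residue_zeros _ c) => //; first by move=> ?; apply: cb.
  rewrite mulrC -ler_pdivrMr// div1r (le_trans (ltW tK))//.
  rewrite ler_weXn2l// ?ltW// (leq_trans (leq_pmulr _ p0))//.
  exact: leq_addr.
have adm : admissible (shift_word i b) 1 (map val ((u ++ nseq k ord0) ++ v)) =
    admissible (shift_word j b) 1 (map val v).
  rewrite -catA !map_cat map_nseq admissible_cat iu size_map shift_wordD.
  rewrite admissible_cat -/t -/m wz size_nseq shift_wordD.
  rewrite admissible_zeros//= => [|?]; last exact: b0.
  by rewrite (shift_word_eqmod bp mkj).
rewrite -adm; split=> [[i' i'p]|]; last by exists i.
by rewrite -catA -(SP _ (Ordinal i'p)) => /umin; rewrite SP.
Qed.

(** Lexicographic maximality of the quasi-greedy word, by which its digits are recovered from the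
    admissible continuations. *)
Lemma admissible_quasi_rcons (R : realType) (b : infword R) n a :
  (forall k, 1 < b k) ->
  admissible b 1 (rcons (mkseq (quasi_word b) n) a) = (a <= quasi_word b n)%N.
Proof.
move=> b1; have [adm res] := admissible_quasi n b1.
rewrite -cats1 admissible_cat adm res size_mkseq /= andbT.
rewrite /shift_word addn0 quasi_digit_max// mulr_gt0//.
  by rewrite (lt_trans ltr01).
by have /andP[] := quasi_rem_itv n b1.
Qed.

Lemma mkseqD (A : Type) (f : nat -> A) m n :
  mkseq f (m + n) = mkseq f m ++ mkseq (fun k => f (m + k)%N) n.
Proof.
by rewrite /mkseq iotaD map_cat add0n -[m in iota m n]addn0 iotaDl -map_comp.
Qed.

Lemma sofic_ultimately_periodic (R : realType) p (b : infword R) j :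
  (0 < p)%N -> alternate_base p b -> sofic (beta_shift p b) ->
  ultimately_periodic (quasi_word (shift_word j b)).
Proof.
move=> p0 bb [N NP]; have [w] := synchronizing_word j p0 bb.
rewrite -NP => wP; set q := quasi_word _.
have b1 k : 1 < shift_word j b k by apply: (proj1 bb).
pose x k : 'I_(max_digit p b).+1 := inord (q k).
have xq k : val (x k) = q k by rewrite /= inordK// ltnS quasi_word_le_max_digit.
have mapx f n :
    map val (mkseq (fun k => x (f k)) n) = mkseq (fun k => q (f k)) n.
  by rewrite /mkseq -map_comp; apply: eq_map => k /=; apply: xq.
have mapx1 n : map val (mkseq x n) = mkseq q n := mapx id n.
pose r n := reach N (w ++ mkseq x n).
(* Equal state sets allow the digits from [m] on to be read after the prefix of length [n]. If the
   tails agree before [k], maximality bounds the next digit; exchanging [m] and [n] gives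
   equality. *)
have half m n k : r m = r n ->
    (forall l, (l < k)%N -> q (m + l)%N = q (n + l)%N) ->
    (q (m + k) <= q (n + k))%N.
  move=> rmn eqk; rewrite -(admissible_quasi_rcons (n + k) _ b1) -/q.
  have -> : rcons (mkseq q (n + k)) (q (m + k)%N) =
      map val (mkseq x n ++ mkseq (fun l => x (m + l)%N) k.+1).
    rewrite map_cat (mapx (addn m)) mapx1 mkseqS -rcons_cat mkseqD.
    congr (rcons (_ ++ _) _); apply/eq_in_map => l; rewrite mem_iota => lk.
    by rewrite eqk.
  apply/wP; rewrite catA; apply: reach_residual rmn _.
  rewrite -catA -mkseqD; apply/wP; rewrite mapx1.
  exact: (admissible_quasi _ b1).1.
have [m [n [mn rmn]]] := pigeonhole_nat r.
have qmn k : q (m + k)%N = q (n + k)%N.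
  elim/ltn_ind: k => k IH; apply/eqP; rewrite eqn_leq !half// => l lk.
  by rewrite IH.
exists m, (n - m)%N; split=> [|k mk]; first by rewrite subn_gt0.
by rewrite -[in RHS](subnKC mk) qmn !addnBA ?(ltnW mn)// addnC.
Qed.

End beta_shifts.

Theorem theorem48 (R : realType) (p : nat) (b : infword R)
    (hp : (1 <= p)%N) (hb : alternate_base p b) :
  sofic (beta_shift p b) <->
  (forall i : nat, (i < p)%N ->
     ultimately_periodic (quasi_greedy (shift_word i b))).
Proof.
have qE i : quasi_greedy (shift_word i b) = quasi_word (shift_word i b).
  apply/funext => k; apply: quasi_greedyE hp _.
  exact: alternate_base_shift.
split=> [sof i _|per]; first by rewrite qE; apply: sofic_ultimately_periodic sof.
by apply: sofic_beta_shift => // i ip; rewrite -qE; apply: per.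
Qed.
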